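(* Let $K$ be a differential field of characteristic zero, let $R=K\{x_1,\ldots,x_n\}$, and let $u_1,u_2,\ldots,u_n\in R$ have order matrix $A=(a_{i,j})$, $a_{i,j}=\operatorname{ord}^{\partial}_{x_j}(u_i)$. Suppose that the system is in Ritt's first form, i.e. $$\operatorname{tdet}(A)=\sum_{i=1}^n a_{i,i}\quad\text{and}\quad a_{2,1}\ge a_{1,1}\ne-\infty.$$ Let $h=su_2-Qu_1$ be the Ritt remainder after $\partial$-division of $u_2$ by $u_1$ in the variable $x_1$ (so $s$ is in the multiplicative set generated by the separant of $u_1$ in $x_1$, and $Q\in R[\partial]$). Then $$J(u_1,h,u_3,\ldots,u_n)\le J(u_1,u_2,u_3,\ldots,u_n).$$
   Context: $K\{x_1,\ldots,x_n\}$ is the ring of differential polynomials over the ordinary differential field $(K,\partial)$, with variables $x_j^{(r)}$, $r\ge0$. For $u\in R$, $\operatorname{ord}^{\partial}_{x_j}(u)=\max\{r\ge 0:\partial u/\partial x_j^{(r)}\neq 0\}$, where the maximum of the empty set is $-\infty$ in the strong convention and $0$ in the weak convention (either convention is fixed throughout). For an $n\times n$ matrix $A$ over $\mathbb{Z}_{\ge0}\cup\{-\infty\}$, $\operatorname{tdet}(A)=\max_{\rho\in S_n}\sum_i a_{i,\rho(i)}$ with $-\infty+a=-\infty$. The Jacobi number $J(u_1,\ldots,u_n)$ is $\operatorname{tdet}$ of the order matrix of $(u_1,\ldots,u_n)$. $R[\partial]$ is the ring of linear differential operators over $R$ ($\partial r=\partial(r)+r\partial$), and $Qu_1$ denotes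 $Q$ applied to $u_1$. If $\operatorname{ord}^{\partial}_{x_1}(g)=a$ and $x_1^{(a)}$ occurs in $g$, the separant of $g$ in $x_1$ is $s_g=\partial g/\partial x_1^{(a)}$. Ritt $\partial$-division of $f$ by $g$ in $x_1$ is the following reduction using only separants: start with $h=f$; while $r=\operatorname{ord}^{\partial}_{x_1}(h)>a$, let $d=\deg_{x_1^{(r)}}h$ and let $c$ be the coefficient of $(x_1^{(r)})^d$ in $h$, and replace $h$ by $s_g h-c\,(x_1^{(r)})^{d-1}\partial^{\,r-a}(g)$. It terminates with a remainder $h=sf-Q(g)$ where $s$ is a power of $s_g$, $Q\in R[\partial]$, and $\operatorname{ord}^{\partial}_{x_1}(h)\le a$.
   Formalization: The formal theorem additionally assumes that J(u_1,…,u_n) is not −∞; in the strong convention the claim fails otherwise, e.g. for u_1 = x_1+x_2+x_3, u_2 = x_1', u_3 = x_1, where J = −∞ but J(u_1,h,u_3) = 1. *)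

(* Defs.v *)
From HB Require Import structures.
From mathcomp Require Import all_boot all_order all_fingroup all_algebra.
From mathcomp Require Export finmap.
From mathcomp.multinomials Require Export monalg.

Set Implicit Arguments.
Unset Strict Implicit.
Unset Printing Implicit Defensive.

Import GRing.Theory.
Local Open Scope ring_scope.

(* Z_{>= 0} together with -oo; [None] stands for -oo. *)
Notation tropnat := (option nat).

Definition tadd (a b : tropnat) : tropnat :=
  if a is Some x then if b is Some y then Some (x + y)%N else None else None.

Definition tmax (a b : tropnat) : tropnat :=
  match a, b with
  | None, _ => b
  | _, None => a
  | Some x, Some y => Some (maxn x y)
  end.

Definition tle (a b : tropnat) : bool :=
  match a, b with
  | None, _ => true
  | Some _, None => false
  | Some x, Some y => (x <= y)%N
  end.

Fact taddA : associative tadd.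
Proof. by case=> [a|] [b|] [c|] //=; rewrite addnA. Qed.
Fact taddC : commutative tadd.
Proof. by case=> [a|] [b|] //=; rewrite addnC. Qed.
Fact tadd0 : left_id (Some 0%N) tadd. Proof. by case. Qed.
HB.instance Definition _ :=
  Monoid.isComLaw.Build tropnat (Some 0%N) tadd taddA taddC tadd0.

Fact tmaxA : associative tmax.
Proof. by case=> [a|] [b|] [c|] //=; rewrite maxnA. Qed.
Fact tmaxC : commutative tmax.
Proof. by case=> [a|] [b|] //=; rewrite maxnC. Qed.
Fact tmaxN : left_id None tmax. Proof. by case. Qed.
HB.instance Definition _ :=
  Monoid.isComLaw.Build tropnat None tmax tmaxA tmaxC tmaxN.

Definition tdet n (A : 'M[tropnat]_n) : tropnat :=
  \big[tmax/None]_(s : 'S_n) \big[tadd/Some 0%N]_(i < n) A i (s i).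

(* The pair (j, r) indexes the variable x_j^(r). *)
Definition dvar n : choiceType := Choice.clone ('I_n * nat)%type _.

Definition dmonom n : conomType := ConomialDef.clone (cmonom (dvar n)) _.
Notation dpoly K n := {malg K[dmonom n]}.

Inductive order_convention := StrongOrder | WeakOrder.

(* This and the next operations are locked because conversion may unfold them on
   distinct arguments without terminating in practice. *)
HB.lock Definition dX (K : fieldType) n (v : dvar n) : dpoly K n := << ucm v >>.
Canonical dX_unlockable := Unlockable dX.unlock.

Definition dvars (K : fieldType) n (u : dpoly K n) : {fset dvar n} :=
  (\bigcup_(m <- msupp u) finsupp (cmonom_val m))%fset.

HB.lock Definition pderiv (K : fieldType) n (v : dvar n) (u : dpoly K n) :
    dpoly K n :=
  \sum_(m <- msupp u) << u@_m *+ m v *g divcm m (ucm v) >>.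
Canonical pderiv_unlockable := Unlockable pderiv.unlock.

Definition derivation (K : fieldType) (delta : K -> K) : Prop :=
  {morph delta : x y / x + y} /\
  (forall x y, delta (x * y) = delta x * y + x * delta y).

(* The derivation of the differential polynomial ring extending [delta] and
   sending x_j^(r) to x_j^(r+1). *)
HB.lock Definition tderiv (K : fieldType) n (delta : K -> K) (u : dpoly K n) :
    dpoly K n :=
  \sum_(m <- msupp u) << delta u@_m *g m >> +
  \sum_(v <- dvars u) pderiv v u * dX K (v.1, v.2.+1).
Canonical tderiv_unlockable := Unlockable tderiv.unlock.

(* The coefficient of v^d when u is read as a polynomial in the variable v. *)
HB.lock Definition dcoef (K : fieldType) n (v : dvar n) (d : nat)
    (u : dpoly K n) : dpoly K n :=
  \sum_(m <- msupp u | m v == d) << u@_m *g divcm m (expcmn (ucm v) d) >>.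
Canonical dcoef_unlockable := Unlockable dcoef.unlock.

Lemma sum_scale_add_Xn (R : comNzRingType) (F : nat -> R) (a b : R)
    (Q : {poly R}) k :
  \sum_(i < size (a *: Q + b *: 'X^k)) (a *: Q + b *: 'X^k)`_i * F i =
  a * (\sum_(i < size Q) Q`_i * F i) + b * F k.
Proof.
have widen (P : {poly R}) N : (size P <= N)%N ->
    \sum_(i < size P) P`_i * F i = \sum_(i < N) P`_i * F i.
  move=> hN; rewrite (big_ord_widen N (fun i => P`_i * F i) hN).
  rewrite big_mkcond; apply: eq_bigr => i _; case: ltnP => // hi.
  by rewrite nth_default ?mul0r.
set P := _ + _; set N := maxn (maxn (size P) (size Q)) k.+1.
rewrite (widen P N) ?(widen Q N) /N ?leq_max ?leqnn ?orbT //= -/N.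
have hN : (k < N)%N by rewrite /N leq_max leqnn orbT.
under eq_bigr => i _ do rewrite /P coefD !coefZ coefXn mulrDl -mulrA.
rewrite big_split /= -mulr_sumr; congr (_ + _).
rewrite (bigD1 (Ordinal hN)) //= eqxx mulr1 big1 ?addr0 //.
by move=> i /negPf; rewrite -val_eqE /= => ->; rewrite mulr0 mul0r.
Qed.

Section DifferentialPolynomials.
Variables (K : fieldType) (n : nat).
Implicit Types (u f g h s : dpoly K n) (v : dvar n) (j : 'I_n).

(* Linear differential operators over the differential polynomials are
   represented by their normal form sum_i q_i D^i, stored as the polynomial with
   coefficients q_i. Addition and left multiplication by a differential
   polynomial agree with those of {poly _}; the product of {poly _} is not
   composition and is never used. *)
Definition diffop := {poly dpoly K n}.

Definition diffop_apply (delta : K -> K) (Q : diffop) u : dpoly K n :=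
  \sum_(i < size Q) Q`_i * iter i (tderiv delta) u.

Definition order_empty (conv : order_convention) : tropnat :=
  if conv is StrongOrder then None else Some 0%N.

(* As all orders are nonnegative, the outer [tmax] only matters when no
   x_j^(r) contributes. Restricting to the finite set [dvars u] loses nothing,
   see [pderiv_notin_dvars]. *)
Definition dord (conv : order_convention) j u : tropnat :=
  tmax (order_empty conv)
    (\big[tmax/None]_(v <- dvars u | (v.1 == j) && (pderiv v u != 0)) Some v.2).

Definition ddeg v u : nat := \max_(m <- msupp u) m v.

(* [ritt_run conv delta j f g s Q h]: the loop of the division of f by g in x_j
   reaches the value h, with accumulated multiplier s and operator Q, so that
   h = s f - Q g; see [ritt_run_spec]. *)
Inductive ritt_run (conv : order_convention) (delta : K -> K) j f g :
    dpoly K n -> diffop -> dpoly K n -> Prop :=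
| RittStart : ritt_run conv delta j f g 1 0 f
| RittStep s Q h (a r : nat) :
    ritt_run conv delta j f g s Q h ->
    dord conv j g = Some a -> dord conv j h = Some r -> (a < r)%N ->
    let sg := pderiv (j, a) g in
    let d := ddeg (j, r) h in
    let q := dcoef (j, r) d h * dX K (j, r) ^+ d.-1 in
    ritt_run conv delta j f g
      (sg * s) (sg *: Q + q *: 'X^(r - a))
      (sg * h - q * iter (r - a)%N (tderiv delta) g).

Definition ritt_remainder conv delta j f g s (Q : diffop) h : Prop :=
  ritt_run conv delta j f g s Q h /\ tle (dord conv j h) (dord conv j g).

Definition order_matrix conv (u : 'I_n -> dpoly K n) : 'M[tropnat]_n :=
  \matrix_(i, j) dord conv j (u i).

Definition jacobi_number conv (u : 'I_n -> dpoly K n) : tropnat :=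
  tdet (order_matrix conv u).

Lemma pderiv_notin_dvars v u : v \notin dvars u -> pderiv v u = 0.
Proof.
move=> hv; rewrite unlock big_seq big1 // => m hm.
case: (eqVneq (m v) 0%N) => [->|mv]; first by rewrite mulr0n monalgU0.
case/negP: hv; apply/bigfcupP; exists m; first by rewrite hm.
by rewrite -cmE_neq0.
Qed.

Lemma ritt_run_spec conv delta j f g s Q h (a : nat) :
  ritt_run conv delta j f g s Q h -> dord conv j g = Some a ->
  (exists k, s = pderiv (j, a) g ^+ k) /\ h = s * f - diffop_apply delta Q g.
Proof.
move=> hrun ha; elim: hrun => [|{}s {}Q {}h b r _ [[k ->] ->]].
  split; first by exists 0%N; rewrite expr0.
  by rewrite /diffop_apply size_poly0 big_ord0 mul1r subr0.
rewrite ha => -[<-] _ _ sg d q; split; first by exists k.+1; rewrite exprS.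
rewrite /diffop_apply (sum_scale_add_Xn (fun i => iter i (tderiv delta) g)).
by rewrite mulrBr mulrA opprD addrA.
Qed.

End DifferentialPolynomials.

(* Indices start at 0: the first two rows and the first column are 0, 1 and 0. *)
Definition ritt_first_form n (A : 'M[tropnat]_n.+2) : Prop :=
  [/\ tdet A = \big[tadd/Some 0%N]_(i < n.+2) A i i,
      tle (A 0 0) (A 1 0) & A 0 0 <> None].

(* Main.v *)
Require Import Defs.
From mathcomp Require Import all_boot all_order all_fingroup all_algebra.
From mathcomp Require Import zify.

(** Write a_ij for the order of u_i in x_j and k for a_10 - a_00 >= 0, with
    indices starting at 0.

    On the differential side, every step of the Ritt division of u_1 by u_0 adds
    to a multiple of the current value a multiple of an iterated derivative of
    u_0. The order in x_0 never rises above a_10, hence at most k derivatives are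
    taken, and each derivative raises an order of u_0 by at most one. So all
    values reached by the loop satisfy
      ord_j h <= max(a_1j, a_0j + k)      for every j,
    which is [ritt_run_order_le]. For j = 0 the right-hand side is a_10, which
    keeps the induction going. In characteristic zero the orders can be read off
    from the variables that occur ([pderiv_neq0]), so these bounds only involve
    the variables of sums, products and derivatives.

    What remains is a statement on matrices, [tdet_replace_row]: if the diagonal
    is a maximal transversal, replacing row 1 by a row with the above bound does
    not increase the tropical determinant. Only transversals s that use a new
    entry bounded by a_(0,s(1)) + k = a_(0,s(1)) + a_10 - a_00 need an argument.
    Read (i, j) as an arrow from i to j. Replacing the arrow 1 -> s(1) of s by the
    two arrows 0 -> s(1) and 1 -> 0 gives a graph in which 0 has two incoming and
    two outgoing arrows and every other vertex one of each. Such a graph is a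
    union of cycles, two of which pass through 0. Separating these two cycles, and
    adding loops where a vertex is missed, turns the graph into two permutations,
    neither of which outweighs the diagonal; this is [two_cycles_le]. *)

Set Implicit Arguments.
Unset Strict Implicit.
Unset Printing Implicit Defensive.

Import GRing.Theory.
Local Open Scope ring_scope.

(** * Order and finite sums in the tropical semiring *)

Lemma tle_refl a : tle a a.
Proof. by case: a => //= a; rewrite leqnn. Qed.

Lemma tle_trans b a c : tle a b -> tle b c -> tle a c.
Proof. by case: a b c => [a|] [b|] [c|] //=; apply: leq_trans. Qed.

Lemma tle_max a b c : tle (tmax a b) c = tle a c && tle b c.
Proof. by case: a b c => [a|] [b|] [c|] //=; rewrite ?geq_max ?andbT. Qed.

Lemma tle_maxl a b : tle a (tmax a b).
Proof. by case: a b => [a|] [b|] //=; rewrite ?leq_maxl. Qed.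

Lemma tle_maxr a b : tle b (tmax a b).
Proof. by rewrite tmaxC tle_maxl. Qed.

Lemma tle_bigmax (I : eqType) (r : seq I) (P : pred I) (F : I -> tropnat) i :
  i \in r -> P i -> tle (F i) (\big[tmax/None]_(j <- r | P j) F j).
Proof.
move=> ri Pi; elim: r ri => // j r IHr.
rewrite inE big_cons => /predU1P[<-|/IHr le_i]; first by rewrite Pi tle_maxl.
by case: ifP => // _; apply: tle_trans le_i (tle_maxr _ _).
Qed.

Lemma bigmax_tle (I : eqType) (r : seq I) (P : pred I) (F : I -> tropnat) c :
  {in r, forall i, P i -> tle (F i) c} ->
  tle (\big[tmax/None]_(i <- r | P i) F i) c.
Proof.
move=> le_c; rewrite big_seq_cond.
apply: (big_ind (tle^~ c)) => // [a b ac bc|i /andP[]]; last exact: le_c.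
by rewrite tle_max ac.
Qed.

Lemma bigtadd_Some (I : finType) (F : I -> tropnat) :
  (forall i, F i) ->
  \big[tadd/Some 0%N]_i F i = Some (\sum_i odflt 0 (F i))%N.
Proof.
move=> Fsome; apply: (big_rec2 (fun a b => a = Some b)) => // i a b _ ->.
by case: (F i) (Fsome i).
Qed.

Lemma bigtadd_finite (I : finType) (F : I -> tropnat) :
  \big[tadd/Some 0%N]_i F i -> forall i, F i.
Proof. by move=> + i; rewrite (bigD1 i) //=; case: (F i). Qed.

(** * Exchange of cycles between permutations *)

Section Cycles.
Variable T : finType.
Implicit Types (f : T -> T -> nat) (E : rel T) (s t : {perm T}) (x y i : T).

Lemma stable_restriction s (C : {set T}) :
  (forall i, (s i \in C) = (i \in C)) ->
  exists t, forall i, t i = if i \in C then s i else i.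
Proof.
move=> sC; pose c i := if i \in C then s i else i.
suff c_inj : injective c by exists (perm c_inj) => i; rewrite permE.
move=> i j; rewrite /c; case: ifP => Ci; case: ifP => Cj // e.
- exact: perm_inj e.
- by rewrite -e sC Ci in Cj.
- by rewrite e sC Cj in Ci.
Qed.

Lemma perm_in_porbit s x i : (s i \in porbit s x) = (i \in porbit s x).
Proof. by have := porbit_perm s 1 i; rewrite -!eq_porbit_mem expg1 => ->. Qed.

(** Multiplying by a transposition changes the number of cycles by one: a join
    of two cycles cannot follow a join, nor a split a split. *)
Lemma tperm_separates s x y :
  x != y -> x \in porbit s y -> x \notin porbit (tperm x y * s)%g y.
Proof.
move=> xy xsy; apply/negP => xty.
have := porbits_mul_tperm s x y; have := porbits_mul_tperm (tperm x y * s)%g x y.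
by rewrite /= mulgA tperm2 mul1g xsy xty xy /=; lia.
Qed.

(** The graph of s with the arrow y -> s y replaced by x -> s y and y -> x. If x
    and y lie on different cycles of s, then one of the two cycles through x is
    the cycle of s at x; the other one goes from x along the cycle of s at y until
    it reaches y, and back to x. The relation E stands for the finite entries of
    a matrix: only permutations with their graph in E compete with the
    diagonal. *)
Lemma two_cycles_le_separated f E s x y :
  x != y -> x \notin porbit s y -> (forall i, E i i) ->
  (forall t, (forall i, E i (t i)) ->
     \sum_i f i (t i) <= \sum_i f i i)%N ->
  (forall i, i != y -> E i (s i)) -> E x (s y) -> E y x ->
  (f x (s y) + f y x + \sum_(i | i != y) f i (s i) <= f x x + \sum_i f i i)%N.
Proof.
move=> xy sep Eid opt Es Exsy Eyx.
(* t1 keeps the cycle of s at x, and t3 below takes all the other arrows; between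
   them they get one added loop at each vertex except x, which explains the term
   f x x of the bound. *)
have [t1 t1E] := stable_restriction (perm_in_porbit s x).
have sC i : (s i \in ~: porbit s x) = (i \in ~: porbit s x).
  by rewrite !in_setC perm_in_porbit.
have [t2 t2E] := stable_restriction sC.
have xC : x \in porbit s x by rewrite porbit_id.
have yC : y \notin porbit s x by rewrite porbit_sym.
have yx : y != x by rewrite eq_sym.
pose t3 := (tperm x y * t2)%g.
have t1x : t1 x = s x by rewrite t1E xC.
have t1y : t1 y = y by rewrite t1E (negPf yC).
have t3x : t3 x = s y by rewrite permM tpermL t2E in_setC yC.
have t3y : t3 y = x by rewrite permM tpermR t2E in_setC xC.
have t3E i : i != x -> i != y -> t3 i = if i \in porbit s x then i else s i.
  move=> ix iy; rewrite permM tpermD 1?eq_sym // t2E in_setC.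
  by case: (i \in _).
have o1 : (\sum_i f i (t1 i) <= \sum_i f i i)%N.
  apply: opt => i; rewrite t1E; case: ifP => // iC; apply: Es.
  by apply: contraNneq yC => <-.
have o3 : (\sum_i f i (t3 i) <= \sum_i f i i)%N.
  apply: opt => i; have [->|ix] := eqVneq i x; first by rewrite t3x.
  have [->|iy] := eqVneq i y; first by rewrite t3y.
  by rewrite t3E //; case: ifP => // _; apply: Es.
have rest : (\sum_(i | (i != x) && (i != y)) f i (t1 i) +
    \sum_(i | (i != x) && (i != y)) f i (t3 i) =
  \sum_(i | (i != x) && (i != y)) f i (s i) +
    \sum_(i | (i != x) && (i != y)) f i i)%N.
  rewrite -!big_split /=; apply: eq_bigr => i /andP[ix iy].
  by rewrite t1E t3E //; case: ifP => // _; rewrite addnC.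
have sumD (g : T -> nat) : (\sum_i g i =
    g x + (g y + \sum_(i | (i != x) && (i != y)) g i))%N.
  by rewrite (bigD1 x) // (bigD1 y).
have sumDy : (\sum_(i | i != y) f i (s i) =
    f x (s x) + \sum_(i | (i != x) && (i != y)) f i (s i))%N.
  by rewrite (bigD1 x) //; under eq_bigl => i do rewrite andbC.
move: o1 o3; rewrite !sumD sumDy t1x t1y t3x t3y; lia.
Qed.

(** The arrows out of x end in s x and s y, and the bound is symmetric in these
    two points. So if x and y share a cycle of s, composing s with the
    transposition of x and y leads to the separated case. *)
Lemma two_cycles_le f E s x y :
  x != y -> (forall i, E i i) ->
  (forall t, (forall i, E i (t i)) ->
     \sum_i f i (t i) <= \sum_i f i i)%N ->
  (forall i, i != y -> E i (s i)) -> E x (s y) -> E y x ->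
  (f x (s y) + f y x + \sum_(i | i != y) f i (s i) <= f x x + \sum_i f i i)%N.
Proof.
move=> xy Eid opt Es Exsy Eyx.
case: (boolP (x \in porbit s y)) => [joined|]; last first.
  by move=> sep; apply: (two_cycles_le_separated xy sep Eid opt).
have tx : (tperm x y * s)%g x = s y by rewrite permM tpermL.
have ty : (tperm x y * s)%g y = s x by rewrite permM tpermR.
have tE i : i != x -> i != y -> (tperm x y * s)%g i = s i.
  by move=> ix iy; rewrite permM tpermD // eq_sym.
have := two_cycles_le_separated xy (tperm_separates xy joined) Eid opt.
rewrite ty !(bigD1 x xy) /= tx.
under eq_bigr => i /andP[iy ix] do rewrite tE //.
move=> le; rewrite [X in (X <= _)%N](_ : _ =
  f x (s x) + f y x + (f x (s y) + \sum_(i | (i != y) && (i != x)) f i (s i)))%N.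
  apply: le => // [i iy|]; last exact: Es.
  by have [->|ix] := eqVneq i x; [rewrite tx | rewrite tE //; apply: Es].
lia.
Qed.
End Cycles.

(** * Tropical determinants *)

Lemma tle_tdet n (A : 'M[tropnat]_n) (s : 'S_n) :
  tle (\big[tadd/Some 0%N]_i A i (s i)) (tdet A).
Proof.
exact: (@tle_bigmax _ _ predT (fun s : 'S_n => \big[tadd/Some 0%N]_i A i (s i))
  _ (mem_index_enum s)).
Qed.

(** Row y may grow up to row x shifted by k, where the difference k of the two
    rows is read off in column x. If the entry of B in row y is at most
    A x (s y) + k, then [two_cycles_le] bounds the weight of s in B plus A x x,
    because A x x + k = A y x is the weight of the arrow y -> x. *)
Lemma tdet_replace_row n (A B : 'M[tropnat]_n) (x y : 'I_n) (k : nat) :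
  x != y ->
  tdet A = \big[tadd/Some 0%N]_i A i i -> tdet A ->
  A y x = tadd (A x x) (Some k) ->
  (forall i j, i != y -> B i j = A i j) ->
  (forall j, tle (B y j) (tmax (A y j) (tadd (A x j) (Some k)))) ->
  tle (tdet B) (tdet A).
Proof.
move=> xy opt; rewrite opt => /bigtadd_finite Aid Ayx BA By.
apply: bigmax_tle => s _ _.
have [Bs|] := boolP (isSome (\big[tadd/Some 0%N]_i B i (s i))); last first.
  by case: (\big[_/_]_i _).
have /bigtadd_finite Bfin := Bs; rewrite !bigtadd_Some //=.
pose f i j := odflt 0%N (A i j).
have optN (t : 'S_n) : (forall i, A i (t i)) ->
    (\sum_i f i (t i) <= \sum_i f i i)%N.
  by move=> At; have := tle_tdet A t; rewrite opt !bigtadd_Some.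
have As i : i != y -> A i (s i) by move=> iy; rewrite -BA.
have -> : (\sum_i odflt 0 (B i (s i)) =
    odflt 0 (B y (s y)) + \sum_(i | i != y) f i (s i))%N.
  by rewrite (bigD1 y) //; congr (_ + _)%N; apply: eq_bigr => i iy; rewrite BA.
have [Ale|Agt] := boolP (tle (B y (s y)) (A y (s y))).
  have Asy : A y (s y) by case: (B y _) (A y _) (Bfin y) Ale => [b|] [a|].
  apply: leq_trans (optN s _) => [|i]; last by have [->|/As] := eqVneq i y.
  rewrite [in leqRHS](bigD1 y) //= leq_add2r /f.
  by case: (B y _) (A y _) Ale => [b|] [a|].
have [p px] : exists p, A x x = Some p.
  by case: (A x x) (Aid x) => // p; exists p.
have [q qx leb] : exists2 q,
    A x (s y) = Some q & (odflt 0 (B y (s y)) <= q + k)%N.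
  move: (By (s y)) Agt (Bfin y).
  case: (B y _) (A y (s y)) (A x (s y)) => [b|] [a|] [q|] //=; last by exists q.
  - by rewrite leq_max => /orP[->|]; last exists q.
  - by rewrite /= => ->.
have := two_cycles_le (f := f) (E := fun i j => A i j) (s := s) xy Aid optN As.
rewrite Ayx px qx => /(_ isT isT); rewrite /f Ayx px qx /=.
move: (\sum_(i | i != y) _)%N (\sum_i _)%N => S T leT.
lia.
Qed.

(** * Order bounds for differential polynomials *)

Section Orders.
Variables (K : fieldType) (n : nat).
Implicit Types (u w f g h : dpoly K n) (v : dvar n) (m : dmonom n).
Implicit Types (b c : 'I_n -> tropnat).

Lemma dvarsP v u :
  reflect (exists2 m, m \in msupp u & m v != 0%N) (v \in dvars u).
Proof.
rewrite /dvars; apply: (iffP (bigfcupP _ _ _ _)) => [[m]|[m um mv]].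
  by rewrite andbT => um mv; exists m => //; rewrite cmE_neq0.
by exists m; rewrite ?um // -cmE_neq0.
Qed.

(** The monomials of u that contain v stay distinct after division by v, so the
    partial derivative has no cancellation beyond the vanishing of an exponent in
    K. *)
Lemma pderiv_neq0 v u : [pchar K] =i pred0 -> v \in dvars u -> pderiv v u != 0.
Proof.
move=> char0 /dvarsP[m um mv].
suff : (pderiv v u)@_(divcm m (ucm v)) != 0.
  by apply: contraNneq => ->; rewrite mcoeff0.
have termE m' : << u@_m' *+ m' v *g divcm m' (ucm v) >>@_(divcm m (ucm v)) =
    if m' == m then u@_m *+ m v else 0.
  rewrite mcoeffU; have [->|mm'] := eqVneq m' m; first by rewrite eqxx.
  have [m'v|m'v] := eqVneq (m' v) 0%N; first by rewrite m'v mulr0n mul0rn.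
  case: eqVneq => [e|_]; last by rewrite mulr0n.
  case/eqP: mm'; apply/eqP/cmP => i; have := congr1 (fun M : cmonom _ => M i) e.
  rewrite !divcmE !ucmE; case: eqVneq => [<-|]; lia.
rewrite unlock (big_morph _ (mcoeffD _) (mcoeff0 _)).
under eq_bigr => m' _ do rewrite termE.
rewrite -big_mkcond -big_filter filter_pred1_uniq ?fset_uniq // big_seq1.
rewrite -mulr_natr mulf_neq0 ?mcoeff_neq0 //.
by rewrite (pcharf0P K).1.
Qed.

(** A bound on the orders through the variables that occur, rather than through
    [dord]: in this form it passes through sums and products without reference to
    partial derivatives or to the order convention. *)
Definition order_le b u := {in dvars u, forall v, tle (Some v.2) (b v.1)}.

Lemma order_leP b u : order_le b u <->
  {in msupp u, forall m v, m v != 0%N -> tle (Some v.2) (b v.1)}.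
Proof.
split=> [le_b m um v mv|le_b v /dvarsP[m um mv]]; last exact: le_b um v mv.
by apply: le_b; apply/dvarsP; exists m.
Qed.

Lemma order_leW b c u :
  (forall j, tle (b j) (c j)) -> order_le b u -> order_le c u.
Proof. by move=> bc ub v uv; apply: tle_trans (bc _); apply: ub. Qed.

Lemma order_leD b u w : order_le b u -> order_le b w -> order_le b (u + w).
Proof.
move=> /order_leP ub /order_leP wb; apply/order_leP => m.
by move/(fsubsetP (msuppD_le _ _)); rewrite in_fsetU => /orP[/ub|/wb].
Qed.

Lemma order_leN b u : order_le b u -> order_le b (- u).
Proof. by move=> /order_leP ub; apply/order_leP => m; rewrite msuppN => /ub. Qed.

Lemma order_leM b u w : order_le b u -> order_le b w -> order_le b (u * w).
Proof.
move=> /order_leP ub /order_leP wb; apply/order_leP => m.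
move=> /msuppM_le[m1 [m2 [um1 wm2 ->]]] v.
rewrite cmM addn_eq0 negb_and => /orP[]; [exact: ub um1 v | exact: wb wm2 v].
Qed.

Lemma order_le_sum b (I : eqType) (r : seq I) (P : pred I) (F : I -> dpoly K n) :
  {in r, forall i, P i -> order_le b (F i)} ->
  order_le b (\sum_(i <- r | P i) F i).
Proof.
move=> Fb; rewrite big_seq_cond; apply: (big_ind (order_le b)).
- by apply/order_leP => m; rewrite msupp0.
- exact: order_leD.
- by move=> i /andP[]; exact: Fb.
Qed.

Lemma order_leU b m (a : K) :
  (forall v, m v != 0%N -> tle (Some v.2) (b v.1)) -> order_le b << a *g m >>.
Proof.
move=> mb; apply/order_leP => m'.
by move/(fsubsetP msuppU_le); rewrite in_fset1 => /eqP ->.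
Qed.

Lemma order_leX b v k : tle (Some v.2) (b v.1) -> order_le b (dX K v ^+ k).
Proof.
move=> vb; elim: k => [|k IHk].
  by rewrite expr0; apply: order_leU => v'; rewrite cm1.
rewrite exprS; apply: order_leM IHk; rewrite unlock; apply: order_leU => v'.
by rewrite ucmE eqb0 negbK => /eqP <-.
Qed.

Lemma order_le_pderiv b v u : order_le b u -> order_le b (pderiv v u).
Proof.
move=> /order_leP ub; rewrite unlock; apply: order_le_sum => m um _.
apply: order_leU => v'; rewrite divcmE => mv'; apply: ub um _ _.
by apply: contraNneq mv' => ->.
Qed.

Lemma order_le_dcoef b v d u : order_le b u -> order_le b (dcoef v d u).
Proof.
move=> /order_leP ub; rewrite unlock; apply: order_le_sum => m um _.
apply: order_leU => v'; rewrite divcmE => mv'; apply: ub um _ _.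
by apply: contraNneq mv' => ->.
Qed.

Lemma order_le_tderiv delta b u :
  order_le b u -> order_le (fun j => tadd (b j) (Some 1%N)) (tderiv delta u).
Proof.
move=> ub; have ub1 : order_le (fun j => tadd (b j) (Some 1%N)) u.
  by apply: order_leW ub => j; case: (b j) => //= k; rewrite leq_addr.
rewrite unlock; apply: order_leD; apply: order_le_sum.
- by move=> m um _; apply: order_leU => v; move/order_leP: ub1 => /(_ _ um v).
- move=> v uv _; apply: order_leM; first exact: order_le_pderiv.
  rewrite -[dX _ _]expr1; apply: order_leX => /=.
  by have := ub _ uv; case: (b _) => //= k; rewrite addn1.
Qed.

Lemma order_le_iter_tderiv delta b u k :
  order_le b u ->
  order_le (fun j => tadd (b j) (Some k)) (iter k (tderiv delta) u).
Proof.
move=> ub; elim: k => [|k IHk] /=.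
  by apply: order_leW ub => j; case: (b j) => //= k; rewrite addn0.
apply: order_leW (order_le_tderiv IHk) => j.
by case: (b j) => //= i; rewrite -addnA addn1.
Qed.

Lemma order_le_dord conv u :
  [pchar K] =i pred0 -> order_le (fun j => dord conv j u) u.
Proof.
move=> char0 v uv; apply: tle_trans (tle_maxr _ _).
apply: (@tle_bigmax _ _ _ (fun v : dvar n => Some v.2)) => //.
by rewrite eqxx pderiv_neq0.
Qed.

Lemma dord_le conv j b u :
  tle (order_empty conv) (b j) -> order_le b u -> tle (dord conv j u) (b j).
Proof.
move=> b0 ub; rewrite tle_max b0; apply: bigmax_tle => v uv /andP[/eqP <- _].
exact: ub.
Qed.

(** The order bound b is preserved by the loop because it is at most a + k in
    x_j: the leading derivative x_j^(r) satisfies r <= a + k, so that the step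
    uses the derivative of g of order r - a <= k, and the power of x_j^(r) that
    multiplies it respects b as well. *)
Lemma ritt_run_order_le conv delta j f g s Q h (a k : nat) :
  [pchar K] =i pred0 -> dord conv j g = Some a ->
  tle (dord conv j f) (Some (a + k)%N) ->
  ritt_run conv delta j f g s Q h ->
  order_le (fun i => tmax (dord conv i f) (tadd (dord conv i g) (Some k))) h.
Proof.
move=> char0 ga fak; set b := fun i => _.
have bj : b j = Some (a + k)%N.
  by rewrite /b ga; case: (dord _ _ f) fak => //= c /maxn_idPr ->.
have b0 i : tle (order_empty conv) (b i).
  exact: tle_trans (tle_maxl _ _) (tle_maxl _ _).
have gb := order_le_dord conv (u := g) char0.
elim=> [|{}s {}Q {}h a' r _ hb].
  by apply: order_leW (order_le_dord conv char0) => i; apply: tle_maxl.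
rewrite ga => -[<-] hr ar sg d q.
have rak : (r <= a + k)%N by have := dord_le (b0 j) hb; rewrite hr bj.
have shift_g l : (l <= k)%N -> order_le b (iter l (tderiv delta) g).
  move=> lk; apply: order_leW (order_le_iter_tderiv gb) => i.
  apply: tle_trans (tle_maxr _ _).
  by case: (dord _ _ g) => //= e; rewrite leq_add2l.
apply: order_leD; first apply: order_leM hb.
  by apply: order_le_pderiv; apply: (shift_g 0%N).
apply/order_leN/order_leM; last by apply: shift_g; rewrite leq_subLR.
apply: order_leM; first exact: order_le_dcoef.
by apply: order_leX; rewrite bj.
Qed.
End Orders.

Theorem proposition5p3 (K : fieldType) (hK : [pchar K] =i pred0)
    (delta : K -> K) (hdelta : derivation delta) (n : nat)
    (conv : order_convention) (u : 'I_n.+2 -> dpoly K n.+2)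
    (hform : ritt_first_form (order_matrix conv u))
    (hfin : tdet (order_matrix conv u) <> None)
    (s : dpoly K n.+2) (Q : diffop K n.+2) (h : dpoly K n.+2)
    (hrem : ritt_remainder conv delta 0 (u 1) (u 0) s Q h) :
  tle (jacobi_number conv [eta u with 1 |-> h]) (jacobi_number conv u).
Proof.
case: hform hrem; rewrite !mxE => opt le01 fin0 [run _].
have [a ga] : exists a, dord conv 0 (u 0) = Some a.
  by case: (dord _ _ (u 0)) fin0 => // a; exists a.
have [k fk] : exists k, dord conv 0 (u 1) = Some (a + k)%N.
  move: le01; rewrite ga; case: (dord _ _ _) => //= c ac.
  by exists (c - a)%N; rewrite subnKC.
apply: (@tdet_replace_row _ _ _ 0 1 k) => //.
- by case: tdet hfin.
- by rewrite !mxE fk ga.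
- by move=> i j i1; rewrite !mxE /= (negPf i1).
move=> j; rewrite !mxE /=.
apply: (dord_le (b := fun i => tmax _ (tadd (dord conv i _) _))).
  exact: tle_trans (tle_maxl _ _) (tle_maxl _ _).
by apply: (ritt_run_order_le hK ga _ run); rewrite fk tle_refl.
Qed.
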